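(* Every 3-tree is odd $5$-colorable.
   Context: All graphs are simple, finite and undirected. A $5$-coloring of a graph $G$ is a map $\varphi:V(G)\to\{1,\dots,5\}$ with $\varphi(u)\neq\varphi(v)$ for every edge $uv$. A vertex $v$ satisfies the odd condition with respect to $\varphi$ if $|\varphi^{-1}(i)\cap N_G(v)|$ is odd for some color $i$. An odd $5$-coloring is a $5$-coloring in which every non-isolated vertex satisfies the odd condition. A graph $G$ is a 3-tree if there is a sequence $G_0,\dots,G_s$ of induced subgraphs of $G$ with $G_0\cong K_4$, $G_s=G$, and for each $i\in\{1,\dots,s\}$, $V(G_i)=V(G_{i-1})\cup\{x_i\}$ for a new vertex $x_i$ whose neighbors in $V(G_{i-1})$ form a clique of order $3$ of $G$. *)

(* Defs.v *)
From mathcomp Require Import all_boot.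

Set Implicit Arguments.
Unset Strict Implicit.
Unset Printing Implicit Defensive.

Record sgraph := SGraph {
  vertex :> finType;
  adj : rel vertex;
  adj_sym : symmetric adj;
  adj_irr : irreflexive adj }.

Definition nbh (G : sgraph) (v : G) : {set G} := [set u | adj v u].

Definition isolated (G : sgraph) (v : G) : Prop := nbh v = set0.

Definition clique (G : sgraph) (A : {set G}) : Prop :=
  forall u v : G, u \in A -> v \in A -> u != v -> adj u v.

(* The colors 1, ..., k are represented by 'I_k. *)
Definition coloring (k : nat) (G : sgraph) (phi : G -> 'I_k) : Prop :=
  forall u v : G, adj u v -> phi u != phi v.

Definition odd_condition (k : nat) (G : sgraph) (phi : G -> 'I_k) (v : G) :
    Prop :=
  exists i : 'I_k, odd #|[set u | phi u == i] :&: nbh v|.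

Definition odd_coloring (k : nat) (G : sgraph) (phi : G -> 'I_k) : Prop :=
  coloring phi /\ forall v : G, ~ isolated v -> odd_condition phi v.

Definition odd_colorable (k : nat) (G : sgraph) : Prop :=
  exists phi : G -> 'I_k, odd_coloring phi.

(* The subgraph induced by A is isomorphic to the complete graph on 'I_n. *)
Definition induced_complete (n : nat) (G : sgraph) (A : {set G}) : Prop :=
  exists f : 'I_n -> G,
    [/\ injective f, A = [set f i | i : 'I_n]
      & forall i j : 'I_n, adj (f i) (f j) = (i != j)].

(* An induced subgraph is determined by its vertex set, so the sequence
   G_0, ..., G_s is given by the sets V 0, ..., V s; the values of V beyond s
   are irrelevant. *)
Definition three_tree (G : sgraph) : Prop :=
  exists (s : nat) (V : nat -> {set G}),
    [/\ induced_complete 4 (V 0),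
        V s = [set: G]
      & forall i : nat, 1 <= i <= s ->
          exists x : G,
            [/\ x \notin V i.-1,
                V i = V i.-1 :|: [set x],
                #|nbh x :&: V i.-1| = 3
              & clique (nbh x :&: V i.-1)]].

(* Main.v *)
Require Import Defs.
From mathcomp Require Import all_boot.

(** In a proper coloring only the parities of the color counts around a vertex
matter.  Cut off the branch of the 3-tree hanging on a triangle abc: its
colorings act on the rest through a set of states, i.e. triples of parity
vectors added to a, b and c, and once everything else is colored all that is
needed is a state that differs at each of a, b, c from the one vector making
that vertex fail.  So a branch may be replaced by any set of states that avoids
no more forbidden triples than the branch does.  With respect to this
domination order, every branch dominates one of four state sets, up to the
order of a, b, c: those of the empty branch, of a single leaf, and of two
slightly larger branches.  This is a finite computation: the list of types is
closed under superposing two branches on a triangle and under removing the last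
vertex x, which turns branches on abx, acx, bcx into one on abc.

The theorem follows by induction along the construction of the 3-tree, for
graphs whose triangles carry gadgets of these types; removing the last vertex
merges the gadgets containing it into a gadget on its three neighbors. *)

Set Implicit Arguments.
Unset Strict Implicit.
Unset Printing Implicit Defensive.

(** * Parity vectors, states and the domination order *)

(* Coordinate j of a vector is the parity of color j.  In a state, colors are
   numbered relative to the triangle: its vertices a, b, c have colors 0, 1, 2,
   and 3, 4 are the remaining two. *)
Definition vec := seq bool.
Definition state := (vec * vec * vec)%type.

Definition rd (u : vec) (j : nat) : bool := nth false u j.
Definition addv (u w : vec) : vec := mkseq (fun j => rd u j (+) rd w j) 5.
Definition sumv (cs : seq nat) : vec := mkseq (fun j => odd (count_mem j cs)) 5.

(* [u] is expressed in the numbering whose color j is color [nth 0 ks j] of the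
   ambient numbering; the result is [u] in the ambient numbering. *)
Definition relabel (ks : seq nat) (u : vec) : vec :=
  mkseq (fun m => rd u (index m ks)) 5.

(** [d] collects the vectors that would make a, b and c fail. *)
Definition avoids (d s : state) : bool :=
  [&& s.1.1 != d.1.1, s.1.2 != d.1.2 & s.2 != d.2].

(** [None] marks a coordinate not fixed yet; a state that is hit avoids no triple extending [p]. *)
Definition hit (p : option vec * option vec * option vec) (s : state) : bool :=
  [|| p.1.1 == Some s.1.1, p.1.2 == Some s.1.2 | p.2 == Some s.2].

(* Searches for a triple [d] extending the partial triple [p] that is avoided by
   no state of [R], branching on the coordinate where [d] agrees with the next
   state of [R], and checks that no state of [T] avoids it either.  The nested
   conditionals keep the search lazy under call-by-value evaluation. *)
Fixpoint dominates_from (p : option vec * option vec * option vec)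
    (T R : seq state) : bool :=
  if R is r :: R' then
    if hit p r then dominates_from p T R' else
    if (if p.1.1 is Some _ then true
        else dominates_from (Some r.1.1, p.1.2, p.2) T R') then
      if (if p.1.2 is Some _ then true
          else dominates_from (p.1.1, Some r.1.2, p.2) T R') then
        if p.2 is Some _ then true
        else dominates_from (p.1.1, p.1.2, Some r.2) T R'
      else false
    else false
  else all (hit p) T.

Definition dominates (T R : seq state) : bool :=
  dominates_from (None, None, None) T R.

(** * Types and the operations on state sets *)

Definition swap01 (s : state) : state :=
  let r := relabel [:: 1; 0; 2; 3; 4] in (r s.1.2, r s.1.1, r s.2).
Definition swap12 (s : state) : state :=
  let r := relabel [:: 0; 2; 1; 3; 4] in (r s.1.1, r s.2, r s.1.2).

Definition mkstate (x y z : seq nat) : state := (sumv x, sumv y, sumv z).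

Definition type_empty : seq state := [:: mkstate [::] [::] [::]].
(** The leaf takes color 3 or 4; seeing three distinct colors once each, it satisfies the odd
    condition by itself. *)
Definition type_leaf : seq state :=
  [:: mkstate [:: 3] [:: 3] [:: 3]; mkstate [:: 4] [:: 4] [:: 4]].

(* The branch made of a vertex x on abc and a leaf on bcx. *)
Definition type_two : seq state :=
  [:: mkstate [:: 3] [:: 0; 3] [:: 0; 3]; mkstate [:: 4] [:: 0; 4] [:: 0; 4];
      mkstate [:: 3] [:: 3; 4] [:: 3; 4]; mkstate [:: 4] [:: 3; 4] [:: 3; 4]].

(* Three of the thirteen states of the branch made of a vertex x on abc, a leaf
   on acx and a copy of the previous branch on bcx, with c in the role of a; they
   suffice for closure. *)
Definition type_three : seq state :=
  [:: mkstate [:: 1; 4] [:: 0; 3; 4] [:: 0; 1; 4];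
      mkstate [:: 3; 4] [:: 0; 2; 4] [:: 0; 3; 4];
      mkstate [:: 1; 3] [:: 2; 3; 4] [:: 1; 3; 4]].

(** [type_two] is invariant under [swap12], hence only three images; [type_three] occurs in all six
    orders of a, b, c. *)
Definition types : seq (seq state) :=
  let s01 := map swap01 in let s12 := map swap12 in
  [:: type_empty; type_leaf;
      type_two; s01 type_two; s12 (s01 type_two);
      type_three; s01 type_three; s12 type_three;
      s12 (s01 type_three); s01 (s12 type_three);
      s01 (s12 (s01 type_three))].

Definition add_state (s1 s2 : state) : state :=
  (addv s1.1.1 s2.1.1, addv s1.1.2 s2.1.2, addv s1.2 s2.2).

Definition sums (S1 S2 : seq state) : seq state :=
  [seq add_state s1 s2 | s1 <- S1, s2 <- S2].

(* Numberings relative to the triangles abx, acx, bcx, when the new vertex has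
   color x (3 or 4, so that 7 - x is the color absent from abcx). *)
Definition frame12 x := [:: 0; 1; x; 2; 7 - x].
Definition frame13 x := [:: 0; 2; x; 1; 7 - x].
Definition frame23 x := [:: 1; 2; x; 0; 7 - x].

(** Parity vector of the new vertex: the colors of a, b, c plus the third components of the branches
    on abx, acx, bcx. *)
Definition apex (x : nat) (s1 s2 s3 : state) : vec :=
  addv (sumv [:: 0; 1; 2])
    (addv (relabel (frame12 x) s1.2)
      (addv (relabel (frame13 x) s2.2) (relabel (frame23 x) s3.2))).

Definition join (x : nat) (s1 s2 s3 : state) : state :=
  let r1 := relabel (frame12 x) in
  let r2 := relabel (frame13 x) in
  let r3 := relabel (frame23 x) in
  let e := sumv [:: x] in
  (addv e (addv (r1 s1.1.1) (r2 s2.1.1)),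
   addv e (addv (r1 s1.1.2) (r3 s3.1.1)),
   addv e (addv (r2 s2.1.2) (r3 s3.1.2))).

(** The new vertex disappears from the resulting states, so its own odd condition is imposed here,
    by the filter. *)
Definition joins (S1 S2 S3 : seq state) : seq state :=
  [seq join y.1 y.2.1.1 y.2.1.2 y.2.2
     | y <- [seq (x, z) | x <- [:: 3; 4],
                z <- [seq (t, s3) | t <- [seq (s1, s2) | s1 <- S1, s2 <- S2],
                                    s3 <- S3]]
     & apex y.1 y.2.1.1 y.2.1.2 y.2.2 != sumv [::]].

Definition dominated (R : seq state) : bool := has (dominates^~ R) types.

(** * Closure of the list of types, by computation *)

Lemma types_swap01 : all (fun S => dominated (map swap01 S)) types.
Proof. by vm_compute. Qed.
Lemma types_swap12 : all (fun S => dominated (map swap12 S)) types.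
Proof. by vm_compute. Qed.
Lemma types_sums :
  all (fun S1 => all (fun S2 => dominated (sums S1 S2)) types) types.
Proof. by vm_compute. Qed.
Lemma types_joins :
  all (fun S1 => all (fun S2 => all (fun S3 =>
    dominated (joins S1 S2 S3)) types) types) types.
Proof. by vm_compute. Qed.
(** Base case: in a bare triangle each vertex sees the colors of the other two, which gives this
    forbidden triple. *)
Lemma types_triangle :
  all (has (avoids (mkstate [:: 1; 2] [:: 0; 2] [:: 0; 1]))) types.
Proof. by vm_compute. Qed.

(** * Correctness of the domination search *)

Definition fits (o : option vec) (u : vec) : Prop :=
  if o is Some w then w = u else True.

Lemma dominates_fromP (p : option vec * option vec * option vec)
    (d : state) (T R : seq state) :
  fits p.1.1 d.1.1 -> fits p.1.2 d.1.2 -> fits p.2 d.2 ->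
  dominates_from p T R -> has (avoids d) T -> has (avoids d) R.
Proof.
elim: R p => [|r R IH] [[p1 p2] p3] /= f1 f2 f3.
  move=> /allP hT /hasP[t tT]; move: {hT} (hT t tT); rewrite /hit /avoids /=.
  case/or3P => /eqP e.
  - by move: f1; rewrite e /= => ->; rewrite eqxx.
  - by move: f2; rewrite e /= => ->; rewrite eqxx andbF.
  - by move: f3; rewrite e /= => ->; rewrite eqxx !andbF.
case: ifP => [_ h mT|nhit h mT]; first by rewrite (IH _ _ _ _ h mT) ?orbT.
case mr : (avoids d r) => //=.
move/negbT: mr nhit; rewrite /avoids /hit !negb_and !negbK /=.
case/or3P => /eqP e; rewrite e in h *.
(* [r] agrees with [d] here. Were this coordinate already fixed, [r] would be hit; otherwise the
   branch fixing it still fits [d]. *)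
- case: p1 f1 h => [w1 ->|_]; first by rewrite eqxx.
  by case: ifP => // h1 _ _; apply: IH h1 mT.
- case: p2 f2 h => [w1 ->|_]; first by rewrite eqxx orbT.
  by case: ifP => // _; case: ifP => // h1 _ _; apply: IH h1 mT.
- case: p3 f3 h => [w1 ->|_]; first by rewrite eqxx !orbT.
  by do 2![case: ifP => // _] => h1 _; apply: IH h1 mT.
Qed.

Lemma dominatesP (d : state) (T R : seq state) :
  dominates T R -> has (avoids d) T -> has (avoids d) R.
Proof. exact: dominates_fromP. Qed.

Lemma dominatedP (R : seq state) : dominated R ->
  exists2 T, T \in types & forall d, has (avoids d) T -> has (avoids d) R.
Proof. by case/hasP => T hT h; exists T => // d; apply: dominatesP. Qed.

Lemma joinsP (S1 S2 S3 : seq state) (s : state) : s \in joins S1 S2 S3 ->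
  exists z s1 s2 s3, [/\ z \in [:: 3; 4], [/\ s1 \in S1, s2 \in S2 & s3 \in S3],
    apex z s1 s2 s3 != sumv [::] & s = join z s1 s2 s3].
Proof.
case/mapP => -[z [[s1 s2] s3]]; rewrite mem_filter => /andP[ax h] ->.
exists z, s1, s2, s3; split => //.
  by have /allpairsP[[z' w] [/= hz _ [-> _]]] := h.
have /allpairsP[[z' w] [/= _ + [_ ew]]] := h; rewrite -ew => /allpairsP[[t w3]].
move=> [/= + h3 [et ->]]; rewrite -et => /allpairsP[[w1 w2]].
by move=> [/= w1S w2S [-> ->]].
Qed.

(** * Numberings of the colors *)

Section Palette.
Variables (col : seq nat).
Hypothesis colP : perm_eq col (iota 0 5).

Lemma size_palette : size col = 5.
Proof. by rewrite (perm_size colP). Qed.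

Lemma palette_uniq : uniq col.
Proof. by rewrite (perm_uniq colP). Qed.

Lemma mem_palette i : (i \in col) = (i < 5).
Proof. by rewrite (perm_mem colP) mem_iota. Qed.

Lemma palette_lt j : j < 5 -> nth 0 col j < 5.
Proof. by move=> ?; rewrite -mem_palette mem_nth ?size_palette. Qed.

Lemma index_palette j : j < 5 -> index (nth 0 col j) col = j.
Proof. by move=> ?; rewrite index_uniq ?palette_uniq ?size_palette. Qed.

Lemma index_palette_lt i : i < 5 -> index i col < 5.
Proof. by rewrite -mem_palette -index_mem size_palette. Qed.

Definition reframe (ks : seq nat) := [seq nth 0 col k | k <- ks].

Lemma reframe_palette ks : perm_eq ks (iota 0 5) ->
  perm_eq (reframe ks) (iota 0 5).
Proof.
move=> kP; apply: perm_trans colP.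
by rewrite -[X in perm_eq _ X](mkseq_nth 0) size_palette perm_map.
Qed.

Lemma index_reframe ks j : perm_eq ks (iota 0 5) -> j < 5 ->
  index (nth 0 col j) (reframe ks) = index j ks.
Proof.
move=> kP j5; have jk : j \in ks by rewrite (perm_mem kP) mem_iota.
rewrite -[in LHS](nth_index 0 jk) -(nth_map 0 0 (nth 0 col)) ?index_mem //.
by rewrite index_uniq ?size_map ?index_mem // (perm_uniq (reframe_palette kP)).
Qed.

(** The vector cancelling [f], read in the numbering [col]: adding it, and only it, leaves all five
    parities even. *)
Definition forbidden (f : nat -> bool) : vec :=
  mkseq (fun j => f (nth 0 col j)) 5.

Lemma neq_forbidden f (u : vec) i : i < 5 -> f i (+) rd u (index i col) ->
  u != forbidden f.
Proof.
move=> i5; apply: contraTneq => ->.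
by rewrite /rd nth_mkseq ?index_palette_lt // nth_index ?mem_palette // addbb.
Qed.

Lemma forbidden_neq f (u : vec) : size u = 5 -> u != forbidden f ->
  exists2 j, j < 5 & f (nth 0 col j) (+) rd u j.
Proof.
move=> su /eqP ne; case h : (has (fun j => f (nth 0 col j) (+) rd u j) (iota 0
  5)).
  by move/hasP: h => [j]; rewrite mem_iota; exists j.
case: ne; apply: (@eq_from_nth _ false); rewrite ?size_mkseq // su => j j5.
rewrite nth_mkseq //; move/negbT/hasPn: h => /(_ j);
  rewrite mem_iota => /(_ j5).
by rewrite /rd addbC negb_add => /eqP.
Qed.

End Palette.

Lemma rd_addv u w j : j < 5 -> rd (addv u w) j = rd u j (+) rd w j.
Proof. by move=> j5; rewrite /rd nth_mkseq. Qed.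

Lemma rd_relabel ks u j : j < 5 -> rd (relabel ks u) j = rd u (index j ks).
Proof. by move=> j5; rewrite {1}/rd nth_mkseq. Qed.

Lemma rd_sumv cs j : j < 5 -> rd (sumv cs) j = odd (count_mem j cs).
Proof. by move=> j5; rewrite {1}/rd nth_mkseq. Qed.

(** * Gadgets on triangles *)

Section Gadgets.
Variable G : sgraph.
Implicit Types (V : {set G}) (phi : G -> nat) (f : G -> nat -> bool).

Definition gadget := (G * G * G * seq state)%type.

(* [col] translates the colors relative to abc into the actual ones; the order
   of the last two is left free. *)
Definition palette phi (a b c : G) (col : seq nat) : Prop :=
  [/\ perm_eq col (iota 0 5), nth 0 col 0 = phi a, nth 0 col 1 = phi b
    & nth 0 col 2 = phi c].

(** The default [[::]] reads as the zero vector, so vertices off the triangle receive nothing. *)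
Definition contrib (a b c : G) (s : state) (col : seq nat) (v : G) (i : nat) :
  bool :=
  rd (if v == a then s.1.1 else if v == b then s.1.2
      else if v == c then s.2 else [::]) (index i col).

(* One can choose a state for every gadget so that no vertex of [V] is left with
   a zero parity vector, [f] being the parities contributed by everything else.
     *)
Fixpoint sat V phi f (ws : seq gadget) : Prop :=
  if ws is (a, b, c, A) :: ws' then
    exists col s, [/\ palette phi a b c col, s \in A
      & sat V phi (fun v i => f v i (+) contrib a b c s col v i) ws']
  else forall v, v \in V -> exists2 i, i < 5 & f v i.

Lemma sat_ext V phi f f' ws : (forall v i, v \in V -> f v i = f' v i) ->
  sat V phi f ws -> sat V phi f' ws.
Proof.
elim: ws f f' => [|[[[a b] c] S] ws IH] f f' e /=.
  by move=> h v vV; case: (h v vV) => i i5 fi; exists i; rewrite -?e.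
case=> col [s [h1 h2 h3]]; exists col, s; split => //.
by apply: IH h3 => v i vV; rewrite e.
Qed.

Lemma sat_swap V phi f g g' ws : sat V phi f (g :: g' :: ws) ->
  sat V phi f (g' :: g :: ws).
Proof.
case: g g' => [[[a b] c] S] [[[a' b'] c'] S'] /= [col [s [h1 h2 [col' [s' [h3
  h4 h5]]]]]].
exists col', s'; split => //; exists col, s; split => //.
by apply: sat_ext h5 => v i _; rewrite addbAC.
Qed.

Definition implies V phi ws ws' := forall f, sat V phi f ws -> sat V phi f ws'.

Lemma implies_cons V phi g ws ws' :
  implies V phi ws ws' -> implies V phi (g :: ws) (g :: ws').
Proof.
move=> h f; case: g => [[[a b] c] S] /= [col [s [h1 h2 h3]]].
by exists col, s; split => //; apply: h.
Qed.

Lemma implies_catl V phi us ws ws' :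
  implies V phi ws ws' -> implies V phi (us ++ ws) (us ++ ws').
Proof. by move=> h; elim: us => //= g us; apply: implies_cons. Qed.

Lemma sat_perm V phi f ws ws' : perm_eq ws ws' -> sat V phi f ws ->
  sat V phi f ws'.
Proof.
have front us g us' : implies V phi (us ++ g :: us') (g :: us ++ us').
  elim: us => [|g' us IH] //= f' /(implies_cons IH); exact: sat_swap.
move=> p h; move: f h; rewrite -/(implies V phi ws ws').
elim: ws' ws p => [|g ws' IH] ws; first by move/perm_nilP ->.
move=> p; have gw : g \in ws by rewrite (perm_mem p) mem_head.
move: p; case/splitPr: gw => us us' p f /front; apply: implies_cons => {}f;
  apply: IH.
by move: p; rewrite -cat1s perm_catCA /= perm_cons.
Qed.

Lemma implies_replace V phi us us' ws :
  implies V phi us us' -> implies V phi (us ++ ws) (us' ++ ws).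
Proof.
move=> h f /(sat_perm (permEl (perm_catC _ _))) /(implies_catl h).
exact/sat_perm/permEl/perm_catC.
Qed.

Lemma sat_empty V phi a b c ws : implies V phi ((a, b, c, type_empty) :: ws) ws.
Proof.
move=> f /= [col [s [_ sS]]]; apply: sat_ext => v i _.
move: sS; rewrite inE => /eqP ->; rewrite /contrib.
have e0 j : rd (sumv [::]) j = false by case: j => [|[|[|[|[|[|j]]]]]].
by case: ifP => _; [|case: ifP => _; [|case: ifP => _]];
  rewrite ?e0 /rd ?nth_nil addbF.
Qed.

(** Passage to the language of domination: the rest of the graph acts on a lone gadget only through
    three forbidden vectors. *)
Lemma sat1_forbidden V phi f a b c S : a \in V -> b \in V -> c \in V ->
  uniq [:: a; b; c] -> sat V phi f [:: (a, b, c, S)] ->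
  exists col, [/\ palette phi a b c col,
    has (avoids (forbidden col (f a), forbidden col (f b), forbidden col (f
      c))) S
  & forall v, v \in V -> v \notin [:: a; b; c] -> exists2 i, i < 5 & f v i].
Proof.
move=> aV bV cV /=; rewrite !inE negb_or andbT => /andP[/andP[ab ac] bc].
case=> col [s [h1 h2 h3]]; have [colP _ _ _] := h1; exists col; split => //.
  apply/hasP; exists s => //; apply/and3P; split; rewrite /=.
  - have [i i5] := h3 a aV; rewrite /contrib eqxx; exact: neq_forbidden.
  - have [i i5] := h3 b bV; rewrite /contrib eq_sym (negPf ab) eqxx;
    exact: neq_forbidden.
  - have [i i5] := h3 c cV; rewrite /contrib 2!(eq_sym c) (negPf ac) (negPf bc)
    eqxx.
    exact: neq_forbidden.
move=> v vV; rewrite !inE !negb_or => /and3P[va vb vc].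
have [i i5] := h3 v vV; rewrite /contrib (negPf va) (negPf vb) (negPf vc).
by rewrite /rd nth_nil addbF; exists i.
Qed.

(** The way back: it suffices that the new parities [f'] differ from [f] by a state avoiding the
    forbidden triple. *)
Lemma avoids_realized V f f' a b c col s :
    perm_eq col (iota 0 5) -> size s.1.1 = 5 -> size s.1.2 = 5 ->
      size s.2 = 5 ->
    avoids (forbidden col (f a), forbidden col (f b), forbidden col (f c)) s ->
    (forall j, j < 5 -> f' a (nth 0 col j) = f a (nth 0 col j) (+) rd s.1.1 j)
      ->
    (forall j, j < 5 -> f' b (nth 0 col j) = f b (nth 0 col j) (+) rd s.1.2 j)
      ->
    (forall j, j < 5 -> f' c (nth 0 col j) = f c (nth 0 col j) (+) rd s.2 j) ->
    (forall v i, v \in V -> v \notin [:: a; b; c] -> f' v i = f v i) ->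
    (forall v, v \in V -> v \notin [:: a; b; c] -> exists2 i, i < 5 & f v i) ->
  forall v, v \in V -> exists2 i, i < 5 & f' v i.
Proof.
move=> colP z1 z2 z3 /and3P[/= m1 m2 m3] e1 e2 e3 e0 rest v vV.
have [|vn] := boolP (v \in [:: a; b; c]); last first.
  by have [i i5 fi] := rest v vV vn; exists i; rewrite ?e0.
rewrite !inE => /or3P[] /eqP ->.
- have [j j5 h] := forbidden_neq z1 m1.
  by exists (nth 0 col j); rewrite ?palette_lt ?e1.
- have [j j5 h] := forbidden_neq z2 m2.
  by exists (nth 0 col j); rewrite ?palette_lt ?e2.
- have [j j5 h] := forbidden_neq z3 m3.
  by exists (nth 0 col j); rewrite ?palette_lt ?e3.
Qed.

Lemma contrib1 a b c s col i : contrib a b c s col a i = rd s.1.1 (index i col).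
Proof. by rewrite /contrib eqxx. Qed.

Lemma contrib2 a b c s col i : b != a ->
  contrib a b c s col b i = rd s.1.2 (index i col).
Proof. by move=> /negPf ba; rewrite /contrib ba eqxx. Qed.

Lemma contrib3 a b c s col i : c != a -> c != b ->
  contrib a b c s col c i = rd s.2 (index i col).
Proof. by move=> /negPf ca /negPf cb; rewrite /contrib ca cb eqxx. Qed.

Lemma contrib0 a b c s col v i : v \notin [:: a; b; c] ->
  contrib a b c s col v i = false.
Proof.
rewrite !inE !negb_or => /and3P[/negPf va /negPf vb /negPf vc].
by rewrite /contrib va vb vc /rd nth_nil.
Qed.

(** * Merging gadgets that share a triangle *)

Lemma uniq3P (a b c : G) : reflect [/\ b != a, c != a & c != b] (uniq [:: a; b;
  c]).
Proof.
rewrite /= !inE negb_or andbT -andbA eq_sym (eq_sym a c) (eq_sym b c);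
  exact: and3P.
Qed.

(** [S] is chosen before [V] and [phi], so gadgets can be replaced before any coloring is known. *)
Definition reduces (a b c : G) (ws : seq gadget) : Prop :=
  exists2 S, S \in types & forall V phi, a \in V -> b \in V -> c \in V ->
    implies V phi [:: (a, b, c, S)] ws.

Lemma reduces_sum a b c S1 S2 : uniq [:: a; b; c] -> S1 \in types ->
  S2 \in types ->
  reduces a b c [:: (a, b, c, S1); (a, b, c, S2)].
Proof.
move=> U h1 h2; have /uniq3P[ba ca cb] := U.
have [S hS dS] := dominatedP (allP (allP types_sums _ h1) _ h2).
exists S => // V phi aV bV cV f /(sat1_forbidden aV bV cV U)[col [pal /dS +
  rest]].
have [colP _ _ _] := pal.
case/hasP => _ /allpairsP[[s1 s2] [/= s1S s2S ->]] m.
exists col, s1; split => //; exists col, s2; split => //.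
apply: (avoids_realized colP _ _ _ m) rest; rewrite ?size_mkseq //.
- by move=> j j5; rewrite !contrib1 index_palette // rd_addv // addbA.
- by move=> j j5; rewrite !contrib2 // index_palette // rd_addv // addbA.
- by move=> j j5; rewrite !contrib3 // index_palette // rd_addv // addbA.
- by move=> v i _ vn; rewrite !contrib0 // !addbF.
Qed.

Lemma reduces_swap01 a b c S : uniq [:: a; b; c] -> S \in types ->
  reduces a b c [:: (b, a, c, S)].
Proof.
move=> U h; have /uniq3P[ba ca cb] := U; have ab : a != b by rewrite eq_sym.
have [S' hS dS] := dominatedP (allP types_swap01 _ h).
exists S' => // V phi aV bV cV f /(sat1_forbidden aV bV cV U)[col [pal /dS +
  rest]].
have [colP p0 p1 p2] := pal.
case/hasP => _ /mapP[s sS ->] m; have kP : perm_eq [:: 1; 0; 2; 3;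
  4] (iota 0 5) by [].
exists (reframe col [:: 1; 0; 2; 3; 4]), s.
split => //; first by split => //; apply: reframe_palette.
apply: (avoids_realized colP _ _ _ m) rest; rewrite ?size_mkseq //.
- by move=> j j5; rewrite contrib2 // index_reframe // rd_relabel.
- by move=> j j5; rewrite contrib1 // index_reframe // rd_relabel.
- by move=> j j5; rewrite contrib3 // index_reframe // rd_relabel.
- move=> v i _ vn; rewrite contrib0 ?addbF //.
  by move: vn; rewrite !inE orbCA.
Qed.

Lemma reduces_swap12 a b c S : uniq [:: a; b; c] -> S \in types ->
  reduces a b c [:: (a, c, b, S)].
Proof.
move=> U h; have /uniq3P[ba ca cb] := U; have bc : b != c by rewrite eq_sym.
have [S' hS dS] := dominatedP (allP types_swap12 _ h).
exists S' => // V phi aV bV cV f /(sat1_forbidden aV bV cV U)[col [pal /dS +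
  rest]].
have [colP p0 p1 p2] := pal.
case/hasP => _ /mapP[s sS ->] m; have kP : perm_eq [:: 0; 2; 1; 3;
  4] (iota 0 5) by [].
exists (reframe col [:: 0; 2; 1; 3; 4]), s.
split => //; first by split => //; apply: reframe_palette.
apply: (avoids_realized colP _ _ _ m) rest; rewrite ?size_mkseq //.
- by move=> j j5; rewrite contrib1 // index_reframe // rd_relabel.
- by move=> j j5; rewrite contrib3 // index_reframe // rd_relabel.
- by move=> j j5; rewrite contrib2 // index_reframe // rd_relabel.
- move=> v i _ vn; rewrite contrib0 ?addbF //.
  by move: vn; rewrite !inE [(v == c) || _]orbC.
Qed.

Lemma reduces_trans a b c x y z ws : all (mem [:: a; b; c]) [:: x; y; z] ->
  (forall S, S \in types -> reduces a b c [:: (x, y, z, S)]) ->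
  reduces x y z ws -> reduces a b c ws.
Proof.
rewrite /= andbT => /and3P[hx hy hz] h [S /h[S' hS' i'] i].
exists S' => // V phi aV bV cV f /(i' V phi aV bV cV).
by apply: i; [move: hx|move: hy|move: hz]; rewrite !inE => /or3P[] /eqP ->.
Qed.

Definition on_triangle (a b c : G) (g : gadget) : bool :=
  all (mem [:: a; b; c]) [:: g.1.1.1; g.1.1.2; g.1.2].

Definition wf_gadget (g : gadget) : bool :=
  uniq [:: g.1.1.1; g.1.1.2; g.1.2] && (g.2 \in types).

(** The two adjacent transpositions generate all six orders of a, b, c. *)
Lemma reduces_one a b c g : uniq [:: a; b; c] -> on_triangle a b c g ->
  wf_gadget g ->
  reduces a b c [:: g].
Proof.
case: g => [[[p q] r] S] U /and4P[/= pI qI rI _] /andP[/= /uniq3P[qp rp rq] hS].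
have /uniq3P[ba ca cb] := U.
have U1 : uniq [:: b; a; c] by apply/uniq3P; split => //; rewrite eq_sym.
have U2 : uniq [:: a; c; b] by apply/uniq3P; split => //; rewrite eq_sym.
have U3 : uniq [:: b; c; a] by apply/uniq3P; split => //; rewrite eq_sym.
have rBAC S' (hS' : S' \in types) := reduces_swap01 U hS'.
have rACB S' (hS' : S' \in types) := reduces_swap12 U hS'.
have rBCA S' : S' \in types -> reduces a b c [:: (b, c, a, S')].
  move=> hS'; apply: reduces_trans rBAC (reduces_swap12 U1 hS').
  by rewrite /= !inE !eqxx !orbT.
move: pI qI rI; rewrite !inE.
case/or3P => /eqP ep; case/or3P => /eqP eq; case/or3P => /eqP er; subst p q r;
  rewrite ?eqxx // in qp rp rq.
- by exists S => // V phi _ _ _ f.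
- exact: rACB.
- exact: rBAC.
- exact: rBCA.
- apply: reduces_trans rACB (reduces_swap01 U2 hS).
  by rewrite /= !inE !eqxx !orbT.
- apply: reduces_trans rBCA (reduces_swap01 U3 hS).
  by rewrite /= !inE !eqxx !orbT.
Qed.

Lemma reduces_all a b c ws : uniq [:: a; b; c] ->
  all (on_triangle a b c) ws -> all wf_gadget ws -> reduces a b c ws.
Proof.
move=> U; elim: ws => [|g ws IH] /=.
  by move=> _ _; exists type_empty => // V phi _ _ _; apply: sat_empty.
move=> /andP[gT /IH {}IH] /andP[gW /IH [S2 hS2 i2]].
have [S1 hS1 i1] := reduces_one U gT gW.
have [S hS i] := reduces_sum U hS1 hS2.
exists S => // V phi aV bV cV f /(i V phi aV bV cV).
move=> /(implies_cons (i2 V phi aV bV cV)).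
exact: (@implies_replace _ _ [:: _] [:: _] _ (i1 V phi aV bV cV)).
Qed.

(** * Removing a vertex *)

Definition recolor phi (x : G) (y : nat) (v : G) : nat :=
  if v == x then y else phi v.

(* Effect on the parities [f] of adding a vertex [x] of color [y] on abc. *)
Definition reparity phi f (a b c x : G) (y : nat) (v : G) (i : nat) : bool :=
  if v == x then odd (count_mem i [:: phi a; phi b; phi c])
  else f v i (+) ((v \in [:: a; b; c]) && (i == y)).

(** Induction on [R] moves the contributions of the other gadgets into [f]; they vanish at [x]. What
    remains is one gadget on abc, where closure under [joins] applies. *)
Lemma join_types a b c x S1 S2 S3 : uniq [:: a; b; c] -> x \notin [:: a; b;
  c] ->
  S1 \in types -> S2 \in types -> S3 \in types ->
  exists2 S, S \in types & forall V phi f (R : seq gadget),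
    a \in V -> b \in V -> c \in V -> x \notin V ->
    all (fun g => x \notin [:: g.1.1.1; g.1.1.2; g.1.2]) R ->
    sat V phi f (R ++ [:: (a, b, c, S)]) ->
    exists y, [/\ y < 5, y \notin [:: phi a; phi b; phi c]
      & sat (x |: V) (recolor phi x y) (reparity phi f a b c x y)
          (R ++ [:: (a, b, x, S1); (a, c, x, S2); (b, c, x, S3)])].
Proof.
move=> U xn h1 h2 h3; have /uniq3P[ba ca cb] := U.
move: (xn); rewrite !inE !negb_or => /and3P[xa xb xc].
have [S hS dS] := dominatedP (allP (allP (allP types_joins _ h1) _ h2) _ h3).
exists S => // V phi f R aV bV cV xV; elim: R f => [|[[[p q] r] S'] R IH] f /=;
  last first.
  move=> /andP[gx /IH {}IH] [col [s [pal sS /IH [y [y5 yn st]]]]].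
  exists y; split => //; exists col, s; split => //.
    move: gx pal; rewrite !inE !negb_or => /and3P[xp xq xr].
    by rewrite /palette /recolor !(eq_sym _ x) (negPf xp) (negPf xq) (negPf xr).
  apply: sat_ext st => v i _; rewrite /reparity; case: eqP => [->|_].
    by rewrite contrib0 ?addbF.
  by rewrite addbAC.
move=> _ /(sat1_forbidden aV bV cV U)[col [[colP p0 p1 p2] /dS + rest]].
case/hasP => _ /joinsP[z [s1 [s2 [s3 [z34 [s1S s2S s3S] ax ->]]]]] m.
have z5 : z < 5 by move: z34; rewrite !inE => /orP[] /eqP ->.
have k1 : perm_eq (frame12 z) (iota 0 5) by move: z34;
  rewrite !inE => /orP[] /eqP ->.
have k2 : perm_eq (frame13 z) (iota 0 5) by move: z34;
  rewrite !inE => /orP[] /eqP ->.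
have k3 : perm_eq (frame23 z) (iota 0 5) by move: z34;
  rewrite !inE => /orP[] /eqP ->.
have nu j k : j < 5 -> k < 5 -> (nth 0 col j == nth 0 col k) = (j == k).
  by move=> j5 k5; rewrite nth_uniq ?size_palette ?palette_uniq.
have [rx [ra rb rc]] : recolor phi x (nth 0 col z) x = nth 0 col z /\
  [/\ recolor phi x (nth 0 col z) a = phi a, recolor phi x (nth 0 col z) b =
    phi b
    & recolor phi x (nth 0 col z) c = phi c].
  by rewrite /recolor eqxx !(eq_sym _ x) (negPf xa) (negPf xb) (negPf xc).
(* The actual color of [x]: [z], which is 3 or 4, translated by [col]. *)
exists (nth 0 col z); split; first exact: palette_lt.
  rewrite -p0 -p1 -p2 !inE !nu //.
  by move: z34; rewrite !inE => /orP[] /eqP ->.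
exists (reframe col (frame12 z)), s1; split => //.
  by split; rewrite ?ra ?rb ?rx //; apply: reframe_palette.
exists (reframe col (frame13 z)), s2; split => //.
  by split; rewrite ?ra ?rc ?rx //; apply: reframe_palette.
exists (reframe col (frame23 z)), s3; split => //.
  by split; rewrite ?rb ?rc ?rx //; apply: reframe_palette.
have [ax' bx' cx'] : [/\ a != x, b != x & c != x] by rewrite !(eq_sym _ x).
have [ab ac bc] : [/\ a != b, a != c & b != c].
  by split; rewrite eq_sym.
move=> v; rewrite in_setU1 => /orP[/eqP ->|].
  (* [sumv [::]] is the vector forbidden by the zero function, so a nonzero [apex] has an odd
     coordinate. *)
  have := @forbidden_neq col (fun=> false) _ _ ax;
    rewrite size_mkseq => /(_ erefl)[j j5].
  rewrite addFb /apex !rd_addv // !rd_relabel // => hj.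
  exists (nth 0 col j); first exact: palette_lt.
  rewrite /reparity eqxx !contrib3 // !index_reframe //.
  move: hj; rewrite rd_sumv // -p0 -p1 -p2 /= !nu //.
  by rewrite !addbA.
move: v; apply: (avoids_realized colP _ _ _ m) rest; rewrite ?size_mkseq //.
- move=> j j5; rewrite /reparity (negPf ax') !contrib1 contrib0; last first.
    by rewrite !inE !negb_or ab ac.
  rewrite !index_reframe // !rd_addv // !rd_relabel // rd_sumv // !inE eqxx /=
    nu //.
  by rewrite addn0 oddb addbF (eq_sym z) !addbA.
- move=> j j5; rewrite /reparity (negPf bx') contrib2 // [contrib a c _ _ _ _
  _]contrib0; last first.
    by rewrite !inE !negb_or ba bc.
  rewrite contrib1 !index_reframe // !rd_addv // !rd_relabel // rd_sumv // !inE
    eqxx orbT /= nu //.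
  by rewrite addn0 oddb addbF (eq_sym z) !addbA.
- move=> j j5; rewrite /reparity (negPf cx') [contrib a b _ _ _ _ _]contrib0;
  last first.
    by rewrite !inE !negb_or ca cb.
  rewrite !contrib2 // !index_reframe // !rd_addv // !rd_relabel // rd_sumv //
    !inE eqxx !orbT /= nu //.
  by rewrite addn0 oddb addbF (eq_sym z) !addbA.
move=> w i wV wn; have wx : w != x by apply: contraNneq xV => <-.
move: (wn); rewrite !inE !negb_or => /and3P[wa wb wc].
rewrite /reparity (negPf wx) (negPf wn) !contrib0 ?addbF //=;
  by rewrite !inE !negb_or ?wa ?wb ?wc wx.
Qed.

(** * Induction along the construction *)

Definition parity V phi (v : G) (i : nat) : bool :=
  odd (\sum_(u in V) (adj v u && (phi u == i))).

Definition valid V (g : gadget) : bool :=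
  [&& all (mem V) [:: g.1.1.1; g.1.1.2; g.1.2],
      [&& adj g.1.1.1 g.1.1.2, adj g.1.1.1 g.1.2 & adj g.1.1.2 g.1.2]
    & g.2 \in types].

Lemma adj_neq (u v : G) : adj u v -> u != v.
Proof. by apply: contraTneq => ->; rewrite adj_irr. Qed.

Lemma adj_uniq (a b c : G) : adj a b -> adj a c -> adj b c -> uniq [:: a; b; c].
Proof.
by move=> /adj_neq ab /adj_neq ac /adj_neq bc; apply/uniq3P;
  rewrite ![_ == a]eq_sym (eq_sym c).
Qed.

Lemma valid_wf V g : valid V g -> wf_gadget g.
Proof. by case/and3P => _ /and3P[? ? ?] hS; rewrite /wf_gadget hS adj_uniq. Qed.

(** Induction hypothesis: arbitrary gadget lists are allowed, so that removed vertices can be stored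
    as gadgets. *)
Definition gadget_colorable V : Prop :=
  forall ws, all (valid V) ws -> exists phi,
    [/\ forall v, v \in V -> phi v < 5,
        forall u v, u \in V -> v \in V -> adj u v -> phi u != phi v
      & sat V phi (parity V phi) ws].

Lemma gadget_colorable_triangle a b c :
  adj a b -> adj a c -> adj b c -> gadget_colorable [set a; b; c].
Proof.
move=> ab ac bc ws wsV; have U := adj_uniq ab ac bc; have /uniq3P[ba ca cb] :=
  U.
set V := [set a; b; c].
have [|S hS h] := @reduces_all a b c ws U _ (sub_all (@valid_wf V) wsV).
  apply: sub_all wsV => g /and3P[/allP gV _ _]; apply/allP => v /gV.
  by rewrite /= !inE -orbA.
have [aV bV cV] : [/\ a \in V, b \in V & c \in V] by rewrite !inE !eqxx !orbT.
pose phi v := if v == a then 0 else if v == b then 1 else 2.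
have [pa pb pc] : [/\ phi a = 0, phi b = 1 & phi c = 2].
  by rewrite /phi !eqxx (negPf ba) (negPf ca) (negPf cb).
have inV v : v \in V -> [\/ v = a, v = b | v = c].
  by rewrite !inE -orbA => /or3P[] /eqP ->;
    [constructor 1|constructor 2|constructor 3].
have pE v i : parity V phi v i = (adj v a && (0 == i)) (+) ((adj v b && (1 ==
  i)) (+) (adj v c && (2 == i))).
  have an : a \notin [set b; c] by rewrite !inE negb_or !(eq_sym a) ba.
  have bn : b \notin [set c] by rewrite inE eq_sym.
  rewrite /parity /V -setUA big_setU1 //= big_setU1 //= big_set1 !oddD !oddb.
  by rewrite pa pb pc.
exists phi; split.
- by move=> v /inV[] ->; rewrite ?pa ?pb ?pc.
- by move=> u v /inV[] -> /inV[] ->; rewrite ?adj_irr ?pa ?pb ?pc.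
apply: h => //; have /hasP[s sS m] := allP types_triangle _ hS.
exists (iota 0 5), s; split; [by rewrite /palette pa pb pc|by []|].
have [z1 z2 z3] : [/\ size s.1.1 = 5, size s.1.2 = 5 & size s.2 = 5].
  have : all (all (fun s => [&& size s.1.1 == 5, size s.1.2 == 5 & size s.2 ==
    5])) types.
    by vm_compute.
  by move=> /allP/(_ _ hS)/allP/(_ _ sS)/and3P[/eqP ? /eqP ? /eqP ?].
have colP : perm_eq (iota 0 5) (iota 0 5) by [].
apply: (@avoids_realized V (parity V phi) _ a b c (iota 0 5) s) => //.
(* The forbidden vectors of the bare triangle, with colors 0, 1, 2, evaluate to the triple of
   [types_triangle]. *)
- move: m; congr (is_true (avoids (_, _, _) s)).
  + by rewrite /forbidden /mkseq /= !pE adj_irr ab ac.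
  + by rewrite /forbidden /mkseq /= !pE adj_irr (adj_sym b a) ab bc.
  + by rewrite /forbidden /mkseq /= !pE adj_irr (adj_sym c a) (adj_sym c b) ac
    bc.
- by move=> j j5; rewrite contrib1 index_palette.
- by move=> j j5; rewrite contrib2 ?index_palette.
- by move=> j j5; rewrite contrib3 ?index_palette.
- by move=> v i _ vn; rewrite contrib0 // addbF.
- by move=> v /inV[] ->; rewrite !inE eqxx ?orbT.
Qed.

(** Gadgets at [x] are merged on abx, acx and bcx, then joined into one on abc. The coloring
    obtained for [V] is extended to [x], and the merged gadgets are expanded back. *)
Lemma gadget_colorable_add V a b c x : gadget_colorable V -> x \notin V ->
  adj a b -> adj a c -> adj b c -> nbh x :&: V = [set a; b; c] ->
  gadget_colorable (x |: V).
Proof.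
move=> gV xV ab ac bc nx ws wsV; have U := adj_uniq ab ac bc.
have /uniq3P[ba ca cb] := U.
have nbV u : u \in V -> adj x u = (u \in [:: a; b; c]).
  move=> uV; move/setP/(_ u): nx; rewrite !inE uV andbT -orbA; exact.
have abcV u : u \in [:: a; b; c] -> u \in V /\ adj x u.
  move=> h; move/setP/(_ u): nx; rewrite !inE -orbA in h *; rewrite h.
  by case/andP.
have [[aV xa] [bV xb] [cV xc]] : [/\ a \in V /\ adj x a, b \in V /\ adj x b & c
  \in V /\ adj x c].
  by split; apply: abcV; rewrite !inE eqxx ?orbT.
have xn : x \notin [:: a; b; c] by apply: contraNN xV => /abcV[].
pose A1 := filter (on_triangle a b x) ws; pose ws1 :=
  filter (predC (on_triangle a b x)) ws.
pose A2 := filter (on_triangle a c x) ws1; pose ws2 :=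
  filter (predC (on_triangle a c x)) ws1.
pose A3 := filter (on_triangle b c x) ws2; pose R :=
  filter (predC (on_triangle b c x)) ws2.
have wsP : perm_eq (A1 ++ A2 ++ A3 ++ R) ws.
  apply: perm_trans (permEl (perm_filterC (on_triangle a b x) ws));
    rewrite perm_cat2l.
  apply: perm_trans (permEl (perm_filterC (on_triangle a c x) ws1));
    rewrite perm_cat2l.
  exact: (permEl (perm_filterC (on_triangle b c x) ws2)).
have : all (valid (x |: V)) (A1 ++ A2 ++ A3 ++ R) by rewrite (perm_all _ wsP).
rewrite !all_cat => /and4P[v1 v2 v3 vR].
(* In a triangle through [x] the other two vertices are neighbors of [x] in [V], hence among a, b,
   c; so it is one of the three filtered out. *)
have Rx g : g \in R -> valid V g && (x \notin [:: g.1.1.1; g.1.1.2; g.1.2]).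
  move=> gR; have := allP vR _ gR; move: gR; rewrite !mem_filter /=.
  case: g => [[[p q] r] S] /and4P[n3 n2 n1 _] /and3P[/= + /and3P[pq pr qr] hS].
  have xnb u : adj x u -> u \in x |: V -> u \in [:: a; b; c].
    move=> xu; rewrite in_setU1 => /orP[/eqP ux|uV]; last by rewrite -nbV.
    by rewrite ux adj_irr in xu.
  rewrite /valid pq pr qr hS !andbT /= => /and3P[pV qV rV].
  have px : x != p.
    apply/eqP => e; subst p; have := xnb _ pq qV; have := xnb _ pr rV.
    move: n1 n2 n3 qr; rewrite /on_triangle /= !inE !eqxx !orbT /=.
    by move=> n1 n2 n3 qr /or3P[] /eqP er /or3P[] /eqP eq; subst q r;
      move: n1 n2 n3 qr; rewrite ?adj_irr // !eqxx ?orbT.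
  have qx : x != q.
    apply/eqP => e; subst q; have := xnb _ qr rV; rewrite adj_sym in pq;
      have := xnb _ pq pV.
    move: n1 n2 n3 pr; rewrite /on_triangle /= !inE !eqxx !orbT /=.
    by move=> n1 n2 n3 pr /or3P[] /eqP er /or3P[] /eqP eq; subst p r;
      move: n1 n2 n3 pr; rewrite ?adj_irr // !eqxx ?orbT.
  have rx : x != r.
    apply/eqP => e; subst r; rewrite adj_sym in qr; rewrite adj_sym in pr.
    have := xnb _ qr qV; have := xnb _ pr pV.
    move: n1 n2 n3 pq; rewrite /on_triangle /= !inE !eqxx !orbT /=.
    by move=> n1 n2 n3 pq /or3P[] /eqP er /or3P[] /eqP eq; subst p q;
      move: n1 n2 n3 pq; rewrite ?adj_irr // !eqxx ?orbT.
  move: pV qV rV; rewrite !in_setU1 !(eq_sym _ x) !inE !negb_or.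
  by rewrite (negPf px) (negPf qx) (negPf rx) /= => -> -> ->.
have U1 : uniq [:: a; b; x] by rewrite adj_uniq // adj_sym.
have U2 : uniq [:: a; c; x] by rewrite adj_uniq // adj_sym.
have U3 : uniq [:: b; c; x] by rewrite adj_uniq // adj_sym.
have [S1 hS1 i1] := reduces_all U1 (filter_all _ _) (sub_all (@valid_wf _) v1).
have [S2 hS2 i2] := reduces_all U2 (filter_all _ _) (sub_all (@valid_wf _) v2).
have [S3 hS3 i3] := reduces_all U3 (filter_all _ _) (sub_all (@valid_wf _) v3).
have [S hS join] := join_types U xn hS1 hS2 hS3.
have [|phi [phi5 pphi st]] := gV (R ++ [:: (a, b, c, S)]).
  rewrite all_cat; apply/andP; split; first by apply/allP => g /Rx /andP[].
  by rewrite /= /valid /= aV bV cV ab ac bc hS.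
have [|y [y5 yn {}st]] := join _ _ _ _ aV bV cV xV _ st.
  by apply/allP => g /Rx /andP[].
have rV v : v \in V -> recolor phi x y v = phi v.
  by move=> vV; rewrite /recolor; case: eqP => // e; rewrite -e vV in xV.
have rx : recolor phi x y x = y by rewrite /recolor eqxx.
have yphi v : v \in V -> adj x v -> y != phi v.
  move=> vV; rewrite nbV //; apply: contraTneq => e; apply: contraNN yn.
  by rewrite !inE e => /or3P[] /eqP ->; rewrite eqxx ?orbT.
exists (recolor phi x y); split.
- by move=> v; rewrite in_setU1 => /orP[/eqP ->|vV]; rewrite ?rx ?rV ?phi5.
- move=> u v; rewrite !in_setU1 => /orP[/eqP ->|uV] /orP[/eqP ->|vV];
  rewrite ?rx ?rV //.
  + by rewrite adj_irr.
  + exact: yphi.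
  + by rewrite adj_sym eq_sym; apply: yphi.
  + exact: pphi.
apply: (sat_perm wsP).
have [xV' aV' bV' cV'] : [/\ x \in x |: V, a \in x |: V, b \in x |: V & c \in x
  |: V].
  by rewrite !in_setU1 eqxx aV bV cV !orbT.
apply: (implies_replace (i1 _ _ aV' bV' xV')).
apply: (@implies_catl _ _ [:: _] _ _ (implies_replace (i2 _ _ aV' cV' xV'))).
apply: (@implies_catl _ _ [:: _; _] _ _ (implies_replace (i3 _ _ bV' cV' xV'))).
apply: (sat_perm (permEl (perm_catC R [:: _; _; _])));
  apply: sat_ext st => v i vV.
(* [reparity] is indeed the parity function of the extended coloring. *)
rewrite /reparity /parity big_setU1 //= rx.
have sumE w : \sum_(u in V) (adj w u && (recolor phi x y u == i)) =
              \sum_(u in V) (adj w u && (phi u == i)).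
  by apply: eq_bigr => u uV; rewrite rV.
rewrite sumE; case: eqP => [->|/eqP vx].
  rewrite adj_irr andFb add0n.
  transitivity (odd (\sum_(u in [set a; b; c]) (phi u == i))); last first.
    congr odd; rewrite -nx [RHS](big_setID (nbh x)) /= [V :&: _]setIC.
    rewrite [X in _ = _ + X]big1 ?addn0 => [|u];
      last by rewrite !inE => /andP[/negPf ->].
    by apply: eq_bigr => u; rewrite !inE => /andP[-> _].
  have an : a \notin [set b; c] by rewrite !inE negb_or !(eq_sym a) ba.
  have bn : b \notin [set c] by rewrite inE eq_sym.
  by rewrite -setUA big_setU1 //= big_setU1 //= big_set1 addn0.
move: vV; rewrite in_setU1 (negPf vx) /= => vV.
by rewrite adj_sym nbV // oddD oddb addbC eq_sym.
Qed.
End Gadgets.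

Theorem theorem1p5 (G : sgraph) : three_tree G -> odd_colorable 5 G.
Proof.
case=> s [V [[f [f_inj V0 fadj]] Vs step]].
have base : gadget_colorable (V 0).
  pose o k (h : k < 4) := f (Ordinal h).
  pose a := @o 0 isT; pose b := @o 1 isT; pose c := @o 2 isT; pose x :=
    @o 3 isT.
  (* The initial complete graph is itself a triangle plus one vertex, so the induction really starts
     at a triangle. *)
  have -> : V 0 = x |: [set a; b; c].
    rewrite V0; apply/setP => v; apply/imsetP/idP => [[i _ ->]|].
      case: i => [[|[|[|[|k]]]] h] //;
        rewrite !inE ?(inj_eq f_inj) -!val_eqE ?orbT //.
    by rewrite !inE -orbA => /or4P[] /eqP ->; eexists.
  have xabc : x \notin [set a; b; c] by rewrite !inE !(inj_eq f_inj).
  apply: (@gadget_colorable_add G _ a b c x) => //; rewrite ?fadj //.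
    by apply: gadget_colorable_triangle; rewrite fadj.
  apply/setP => v; rewrite in_setI [v \in nbh x]inE andbC.
  case vI : (v \in _) => //=; move: vI.
  by rewrite !inE -orbA => /or3P[] /eqP ->; rewrite fadj.
have all_steps i : i <= s -> gadget_colorable (V i).
  elim: i => [|i IH] // lt; have [x [/= xV -> card cl]] := step i.+1 lt.
  rewrite setUC; have gV := IH (ltnW lt).
  have e : [set v in enum (nbh x :&: V i)] = nbh x :&: V i.
    by apply/setP => v; rewrite inE mem_enum.
  have := enum_uniq (nbh x :&: V i); move: card e; rewrite cardE.
  case: (enum _) => [|a [|b [|c [|]]]] //= _ e /uniq3P[ba ca cb].
  have abcP v : v \in [:: a; b; c] -> v \in nbh x :&: V i.
    by rewrite -e => h; rewrite inE.
  have [ma mb mc] : [/\ a \in nbh x :&: V i, b \in nbh x :&: V i & c \in nbh x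
    :&: V i].
    by split; apply: abcP; rewrite !inE eqxx ?orbT.
  apply: (@gadget_colorable_add G _ a b c x gV xV); try by apply: cl => //;
    rewrite eq_sym.
  by rewrite -e; apply/setP => v; rewrite !inE -orbA.
(* Without gadgets, [sat] is the odd condition at every vertex. *)
have [phi [phi5 pphi st]] := all_steps s (leqnn s) [::] isT;
  rewrite Vs in phi5 pphi st.
have ordE k : k < 5 -> nat_of_ord (inord k : 'I_5) = k by exact: inordK.
have phiE v : nat_of_ord (inord (phi v) : 'I_5) = phi v by rewrite ordE ?phi5.
exists (fun v => inord (phi v)); split.
  move=> u v uv; apply: contraNneq (pphi u v (in_setT _) (in_setT _) uv).
  by move=> /(congr1 (@nat_of_ord 5)); rewrite !phiE => ->.
move=> v _; have [i i5] := st v (in_setT v); rewrite /parity => oi.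
exists (inord i); rewrite -sum1_card big_mkcond /=; move: oi;
  congr (is_true (odd _)).
rewrite big_mkcond /=; apply: eq_bigr => u _.
by rewrite !inE -val_eqE /= phiE ordE // andbC; case: (_ && _).
Qed.
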